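(* Let $\mathbb{F}$ be a finite field of odd order $q$ and let $(a,b)\in\Sigma$. Define $\mu=b^2-2b+a$, $\nu=a^2-2a+b$, $\sigma=a^2b-a^2-ab+b$ and $\tau=a^2b-ab-a+b$. Then $Q_{a,b}$ is maximally nonassociative if and only if all of the following conditions hold: (1) $a^2\ne b$ or $a\ne 2b-b^2$; (2) at least one of $-1$, $a-1$ or $a$ is nonsquare; (3) at least one of $b$, $(1-a)(a^2-b)$ or $\sigma(a-1)$ is square; (4) at least one of $a\nu$, $1-b$ or $a\tau$ is square; (5) $-1$ is nonsquare or $\sigma a(b-1)$ is square or $\tau a(b-1)$ is square; (6) $-1$ is square or $b-1$ is nonsquare or $(ab-a+b)b$ is nonsquare; (7) $(b-a^2)\mu$ is square or $b\mu(ab-2a+1)$ is nonsquare or $(a-1)(ab-a+b)\mu$ is square; (8) $-1$ is square or $a-1$ is square or $b$ is nonsquare; (9) at least one of $-1$, $a$ or $(ab-2a+1)(b-1)$ is square; (10) conditions (1)–(9) all hold when $a$ and $b$ are interchanged (which also interchanges $\mu$ with $\nu$, and replaces $\sigma$ by $b^2a-b^2-ab+a$ and $\tau$ by $b^2a-ab-b+a$).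
   Context: An element $x$ of a field $\mathbb{F}$ is a square if $x=y^2$ for some $y\in\mathbb{F}$ (so $0$ is a square); otherwise it is a nonsquare. For a finite field $\mathbb{F}$ of odd order, $\Sigma$ denotes the set of all $(a,b)\in\mathbb{F}\times\mathbb{F}$ such that $0\notin\{a,b,a-1,b-1\}$, $a\ne b$, and both $ab$ and $(a-1)(b-1)$ are squares. For $(a,b)\in\Sigma$ let $\psi\colon\mathbb{F}\to\mathbb{F}$ be given by $\psi(x)=ax$ if $x$ is a square and $\psi(x)=bx$ if $x$ is a nonsquare, and let $Q_{a,b}$ be the set $\mathbb{F}$ with the operation $x*y=x+\psi(y-x)$; it is known that for $(a,b)\in\Sigma$ this is a quasigroup (i.e. for all $c,d$ the equations $x*c=d$ and $c*y=d$ have unique solutions). A quasigroup $(Q,* )$ is maximally nonassociative if for all $x,y,z\in Q$, $x*(y*z)=(x*y)*z$ implies $x=y=z$. *)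

(* Defs.v *)
From HB Require Import structures.
From mathcomp Require Import all_boot all_algebra.

Set Implicit Arguments.
Unset Strict Implicit.
Unset Printing Implicit Defensive.

Import GRing.Theory.
Local Open Scope ring_scope.

Definition is_quasigroup (Q : Type) (op : Q -> Q -> Q) : Prop :=
  forall c d : Q, (exists! x, op x c = d) /\ (exists! y, op c y = d).

Definition maximally_nonassociative (Q : Type) (op : Q -> Q -> Q) : Prop :=
  is_quasigroup op /\
  (forall x y z : Q, op x (op y z) = op (op x y) z -> x = y /\ y = z).

Section QuadraticOrthomorphisms.

Variable F : finFieldType.
Implicit Types a b x y : F.

Definition is_square x : bool := [exists y, x == y ^+ 2].

Definition Sigma : {set F * F} :=
  [set p : F * F | let: (a, b) := p in
     [&& 0 \notin [:: a; b; a - 1; b - 1], a != b,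
         is_square (a * b) & is_square ((a - 1) * (b - 1))]].

Definition psi a b x : F := if is_square x then a * x else b * x.

Definition Qop a b x y : F := x + psi a b (y - x).

Definition mu a b : F := b ^+ 2 - 2 * b + a.
Definition nu a b : F := a ^+ 2 - 2 * a + b.
Definition sigma a b : F := a ^+ 2 * b - a ^+ 2 - a * b + b.
Definition tau a b : F := a ^+ 2 * b - a * b - a + b.

Definition cond1 a b : Prop := a ^+ 2 <> b \/ a <> 2 * b - b ^+ 2.

Definition cond2 a b : Prop :=
  ~ is_square (-1) \/ ~ is_square (a - 1) \/ ~ is_square a.

Definition cond3 a b : Prop :=
  is_square b \/ is_square ((1 - a) * (a ^+ 2 - b)) \/
  is_square (sigma a b * (a - 1)).

Definition cond4 a b : Prop :=
  is_square (a * nu a b) \/ is_square (1 - b) \/ is_square (a * tau a b).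

Definition cond5 a b : Prop :=
  ~ is_square (-1) \/ is_square (sigma a b * a * (b - 1)) \/
  is_square (tau a b * a * (b - 1)).

Definition cond6 a b : Prop :=
  is_square (-1) \/ ~ is_square (b - 1) \/ ~ is_square ((a * b - a + b) * b).

Definition cond7 a b : Prop :=
  is_square ((b - a ^+ 2) * mu a b) \/
  ~ is_square (b * mu a b * (a * b - 2 * a + 1)) \/
  is_square ((a - 1) * (a * b - a + b) * mu a b).

Definition cond8 a b : Prop :=
  is_square (-1) \/ is_square (a - 1) \/ ~ is_square b.

Definition cond9 a b : Prop :=
  is_square (-1) \/ is_square a \/
  is_square ((a * b - 2 * a + 1) * (b - 1)).

Definition conds1to9 a b : Prop :=
  cond1 a b /\ cond2 a b /\ cond3 a b /\ cond4 a b /\ cond5 a b /\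
  cond6 a b /\ cond7 a b /\ cond8 a b /\ cond9 a b.

End QuadraticOrthomorphisms.

(* Main.v *)
Require Import Defs.
From mathcomp Require Import all_boot all_algebra all_fingroup all_solvable ring.

(** Translating by [y], an associative triple [(x, y, z)] becomes a solution of
    [psi (psi z + w) = psi w + psi (z + w - psi w)] (with [z], [w] standing for [z - y],
    [y - x]), which is trivial iff [z = 0].  Scaling by a nonsquare exchanges [a] and [b], so a
    nontrivial solution may be taken with [z] a square.  Fixing which of [w], [a z + w] and
    [z + w - psi w] are squares turns the equation into a linear one, with a solution unique up
    to scaling; requiring its quadratic characters to be the prescribed ones gives the negation
    of one of the conditions (2)-(9), one for each of the eight patterns.  The linear equation
    degenerates only when (1) fails, and then (2) or (8) fails as well. *)

Set Implicit Arguments.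
Unset Strict Implicit.
Unset Printing Implicit Defensive.

Import GRing.Theory.
Local Open Scope ring_scope.

(** * Squares and nonsquares in a finite field *)

Section QuadraticOrthomorphism.

Variable F : finFieldType.
Implicit Types a b n s w x y z : F.

Lemma is_squareP x : reflect (exists y, x = y ^+ 2) (is_square x).
Proof. by apply: (iffP existsP) => -[y /eqP]; exists y => //; apply/eqP. Qed.

Lemma is_square0 : is_square (0 : F).
Proof. by apply/is_squareP; exists 0; rewrite expr0n. Qed.

Lemma is_square_cancel x y : x != 0 -> is_square x ->
  is_square (x * y) = is_square y.
Proof.
move=> x0 /is_squareP [u xE]; have u0 : u != 0.
  by apply: contraNneq x0 => u0; rewrite xE u0 expr0n.
apply/is_squareP/is_squareP => -[v vE]; last first.
  by exists (u * v); rewrite xE vE exprMn.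
exists (v / u); rewrite exprMn -vE xE exprVn [_ * y]mulrC mulfK //.
by rewrite expf_neq0.
Qed.

(* The units form a cyclic group, and nonsquares are the odd powers of a generator. *)
Lemma nonsquareM x y : ~~ is_square x -> ~~ is_square y -> is_square (x * y).
Proof.
have /cyclicP [g gE] := field_unit_group_cyclic [set: {unit F}]%G.
have odd_exp u : ~~ is_square u -> exists2 i, odd i & u = FinRing.uval g ^+ i.
  move=> nu; have u0 : u \is a GRing.unit.
    by rewrite unitfE; apply: contraNneq nu => ->; apply: is_square0.
  have : FinRing.Unit u0 \in <[g]>%g by rewrite -gE inE.
  case/cycleP => i /(congr1 (@FinRing.uval F)) /=; rewrite FinRing.val_unitX => uE.
  exists i => //; apply: contraNT nu => even_i; apply/is_squareP.
  exists (FinRing.uval g ^+ i./2).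
  by rewrite uE -exprM muln2 -[in LHS](odd_double_half i) (negbTE even_i).
move=> /odd_exp [i oi ->] /odd_exp [j oj ->]; apply/is_squareP.
exists (FinRing.uval g ^+ (i + j)./2).
by rewrite -exprD -exprM muln2 -[in LHS](odd_double_half (i + j)) oddD oi oj.
Qed.

Lemma is_squareM x y : x != 0 -> y != 0 ->
  is_square (x * y) = ~~ (is_square x (+) is_square y).
Proof.
move=> x0 y0; have [sx|nx] := boolP (is_square x).
  by rewrite is_square_cancel //= negbK.
have [sy|ny] := boolP (is_square y); last by rewrite nonsquareM.
by rewrite mulrC is_square_cancel // (negbTE nx).
Qed.

Lemma is_squareN x : x != 0 -> is_square (- x) = ~~ (is_square (-1 : F) (+) is_square x).
Proof. by move=> x0; rewrite -[in LHS]mulN1r is_squareM // oppr_eq0 oner_eq0. Qed.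

(** If every element were a square, squaring would be a bijection of the finite set [F], hence
    injective; but [-1] and [1] have the same square and differ in odd order. *)
Lemma exists_nonsquare : odd #|F| -> exists n : F, ~~ is_square n.
Proof.
move=> oddF; apply/existsP; apply: contraT; rewrite negb_exists => /forallP sqF.
have [r rK] : exists r : F -> F, forall x, r x ^+ 2 = x.
  apply: (@fin_all_exists F (fun=> F) (fun x y => y ^+ 2 = x)) => x.
  by have := sqF x; rewrite negbK => /is_squareP [y ->]; exists y.
have rI : injective r by apply: (can_inj (g := fun y => y ^+ 2)).
have [g gK rgK] := injF_bij rI.
have sqrI (x y : F) : x ^+ 2 = y ^+ 2 -> x = y.
  by rewrite -(rgK x) -(rgK y) !rK => ->.
have N1 : (-1 : F) = 1 by apply: sqrI; rewrite sqrrN.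
have /eqP := oner_neq0 F; case.
have two0 : (1 : F) *+ 2 = 0 by rewrite mulr2n -{1}N1 addNr.
(* The order of the additive group kills [1]; with [two0] and [#|F|] odd this gives [1 = 0]. *)
have card0 : (1 : F) *+ #|F| = 0.
  by rewrite -FinRing.zmodXgE -cardsT expg_cardG ?inE.
by rewrite -card0 -[#|F|]odd_double_half oddF mulrnDr -mul2n mulrnA two0 mul0rn addr0.
Qed.

Lemma is_square1 : is_square (1 : F).
Proof. by apply/is_squareP; exists 1; rewrite expr1n. Qed.

Lemma is_square_sqr x : is_square (x ^+ 2).
Proof. by apply/is_squareP; exists x. Qed.

Lemma nonsquare_neq0 x : ~~ is_square x -> x != 0.
Proof. by apply: contraNneq => ->; apply: is_square0. Qed.

(** Reduces deducing one equation from another to an identity that [ring] can check. *)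
Lemma eq_from_sub (l r x y : F) : l = r -> x - y = l - r -> x = y.
Proof. by move=> -> /eqP; rewrite subrr subr_eq0 => /eqP. Qed.

(** As [z] and [w] are nonzero, the coefficients vanish together. If they do not, the solutions form
    a line, parametrized by [s]. *)
Lemma proportional (c1 c2 z w : F) : z != 0 -> w != 0 -> c1 * z = c2 * w ->
  (c1 = 0 /\ c2 = 0) \/
  exists s, [/\ s != 0, c1 != 0, c2 != 0, z = c2 * s & w = c1 * s].
Proof.
move=> z0 w0 e; have [c10|c10] := eqVneq c1 0.
  left; split=> //; apply/eqP; move/eqP: e; rewrite c10 mul0r eq_sym mulf_eq0.
  by rewrite (negbTE w0) orbF.
right; exists (w / c1); have zE : z = c2 * (w / c1).
  by apply: (mulfI c10); rewrite e; field.
split=> //; last by rewrite mulrC divfK.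
  by rewrite mulf_neq0 ?invr_neq0.
by apply: contraNneq z0 => c20; rewrite zE c20 mul0r.
Qed.

End QuadraticOrthomorphism.

(** * Tactics for nonvanishing and for comparing quadratic characters *)

Ltac neq0 :=
  repeat first [assumption | rewrite oppr_eq0 | apply: mulf_neq0 | apply: expf_neq0].

(* Factors whose nonvanishing is not in the context are left alone: [is_square] is not
   multiplicative at [0]. *)
Ltac square_cases :=
  repeat match goal with
  | H : is_true (is_square _) |- _ => revert H
  | H : is_true (~~ is_square _) |- _ => revert H
  | H : @eq bool _ _ |- _ => revert H
  end;
  rewrite ?is_square_sqr;
  repeat match goal with
  | |- context [is_square (?x * ?y)] =>
      rewrite (@is_squareM _ x y); [|by neq0|by neq0]
  | |- context [is_square (- ?x)] =>
      lazymatch x with GRing.one _ => fail | _ => rewrite (@is_squareN _ x); [|by neq0] end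
  | |- context [is_square (?x ^+ 2)] => rewrite (is_square_sqr x)
  end;
  repeat match goal with |- context [is_square ?x] => case: (is_square x) end;
  by [].

(** * The associativity equation in terms of differences *)

Section Associativity.

Variable F : finFieldType.
Implicit Types a b n s w x y z : F.

(* For [z = z' - y'] and [w = y' - x'], this is [x' * (y' * z') = (x' * y') * z'] in [Q_{a,b}]. *)
Definition assoc_pair a b z w :=
  psi a b (psi a b z + w) = psi a b w + psi a b (z + w - psi a b w).

Definition trivially_assoc a b := forall z w, assoc_pair a b z w -> z = 0.

(** The booleans prescribe the characters of [w], [k] and [l]. Keeping [k] and [l] as variables
    allows them to be supplied in factored form, from which their characters can be read off. *)
Lemma assoc_pairI a b z w k l (ew ek el : bool) :
  let c e := if e then a else b in
  is_square z -> is_square w = ew ->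
  a * z + w = k -> z + w - c ew * w = l ->
  is_square k = ek -> is_square l = el ->
  c ek * k = c ew * w + c el * l -> assoc_pair a b z w.
Proof.
move=> c sz sw kE lE sk sl e.
have psiE x ex : is_square x = ex -> psi a b x = c ex * x.
  by rewrite /psi /c => ->; case: ex.
by rewrite /assoc_pair (psiE _ _ sz) (psiE _ _ sw) kE lE (psiE _ _ sk) (psiE _ _ sl).
Qed.

(** * Necessity: a failing condition yields a nontrivial associative pair *)

Section Conditions.

Variables a b : F.
Hypotheses (a0 : a != 0) (b0 : b != 0) (a1 : a - 1 != 0) (b1 : b - 1 != 0).
Hypothesis sab : is_square a = is_square b.
Hypothesis sab1 : is_square (a - 1) = is_square (b - 1).
Hypothesis triv : trivially_assoc a b.

(** In each use below, the equation of the pattern simplifies to [c1 * z = c2 * w], and the pair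
    chosen is [z = c2 ^+ 2], [w = c1 * c2], so that [z] is a square. *)
Let witness z w k l ew ek el : z != 0 ->
  let c e := if e then a else b in
  is_square z -> is_square w = ew ->
  a * z + w = k -> z + w - c ew * w = l ->
  is_square k = ek -> is_square l = el ->
  c ek * k = c ew * w + c el * l -> False.
Proof.
move=> z0 c sz sw kE lE sk sl e; move/eqP: z0; apply.
exact: triv (assoc_pairI sz sw kE lE sk sl e).
Qed.

Lemma trivial_cond2 : cond2 a b.
Proof.
rewrite /cond2; have [m|m] := boolP (is_square (-1 : F)); last by left.
have [s1|s1] := boolP (is_square (a - 1)); last by right; left.
have [sa|sa] := boolP (is_square a); last by right; right.
(* With all characters square, the equation is [a * (a - 1) * (z + w) = 0]. *)
exfalso; apply: (@witness 1 (-1) (a - 1) a true true true) => //; try ring.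
- exact: oner_neq0.
- exact: is_square1.
Qed.

Lemma trivial_cond3 : cond3 a b.
Proof.
rewrite /cond3; have [m|n1] := boolP (is_square b); first by left.
have [m|n2] := boolP (is_square ((1 - a) * _)); first by right; left.
have [m|n3] := boolP (is_square (sigma a b * _)); first by right; right.
exfalso.
(* Since [0] is a square, a nonsquare product has nonzero factors. *)
have c0 : a ^+ 2 - b != 0.
  by have := nonsquare_neq0 n2; rewrite mulf_eq0 negb_or => /andP [].
have g0 : sigma a b != 0.
  by have := nonsquare_neq0 n3; rewrite mulf_eq0 negb_or => /andP [].
have E : 1 - a = - (a - 1) by ring.
rewrite E in n2.
(* Here [c1 = a ^+ 2 - b] and [c2 = - (b * (a - 1))]. *)
apply: (@witness ((b * (a - 1)) ^+ 2) (- ((a ^+ 2 - b) * (b * (a - 1))))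
   (sigma a b * (b * (a - 1))) (b * (a * (a - 1)) ^+ 2) true true false);
  rewrite /=; try (rewrite /sigma; ring).
- by neq0.
- by square_cases.
- by square_cases.
- by square_cases.
- by square_cases.
Qed.

Lemma trivial_cond4 : cond4 a b.
Proof.
rewrite /cond4; have [m|n1] := boolP (is_square (a * nu a b)); first by left.
have [m|n2] := boolP (is_square (1 - b)); first by right; left.
have [m|n3] := boolP (is_square (a * tau a b)); first by right; right.
exfalso.
have c0 : nu a b != 0.
  by have := nonsquare_neq0 n1; rewrite mulf_eq0 negb_or => /andP [].
have g0 : tau a b != 0.
  by have := nonsquare_neq0 n3; rewrite mulf_eq0 negb_or => /andP [].
rewrite -(opprB b 1) in n2.
apply: (@witness (nu a b ^+ 2) (- (a * (b - 1) * nu a b))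
   (a * nu a b * (a - 1) ^+ 2) (nu a b * tau a b) true false true);
  rewrite /=; try (rewrite /nu /tau; ring).
- by neq0.
- by square_cases.
- by square_cases.
- by square_cases.
- by square_cases.
Qed.

Lemma trivial_cond5 : cond5 a b.
Proof.
rewrite /cond5; have [m|m] := boolP (is_square (-1 : F)); last by left.
have [n|n1] := boolP (is_square (sigma a b * _ * _)); first by right; left.
have [n|n2] := boolP (is_square (tau a b * _ * _)); first by right; right.
exfalso.
have c0 : sigma a b != 0.
  by have := nonsquare_neq0 n1; rewrite !mulf_eq0 !negb_or -andbA => /andP [].
have g0 : tau a b != 0.
  by have := nonsquare_neq0 n2; rewrite !mulf_eq0 !negb_or -andbA => /andP [].
apply: (@witness ((a * (b - 1)) ^+ 2) (- (b * (a - 1) * (a * (b - 1))))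
   (sigma a b * a * (b - 1)) (tau a b * a * (b - 1)) true false false);
  rewrite /=; try (rewrite /sigma /tau; ring).
- by neq0.
- by square_cases.
- by square_cases.
- by square_cases.
- by square_cases.
Qed.

Lemma trivial_cond6 : cond6 a b.
Proof.
rewrite /cond6; have [m|m] := boolP (is_square (-1 : F)); first by left.
have [s1|n] := boolP (is_square (b - 1)); last by right; left.
have [s2|n] := boolP (is_square (_ * b)); last by right; right.
exfalso.
apply: (@witness (b ^+ 2) (- (a * b)) (a * b * (b - 1)) ((a * b - a + b) * b)
   false true true); rewrite /=; try ring.
- by neq0.
- by square_cases.
- by square_cases.
- by square_cases.
- by square_cases.
Qed.

Lemma trivial_cond7 : cond7 a b.
Proof.
rewrite /cond7; have [m|n1] := boolP (is_square ((b - _) * _)); first by left.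
have [s2|n] := boolP (is_square (b * mu a b * _)); last by right; left.
have [m|n3] := boolP (is_square ((a - 1) * _ * _)); first by right; right.
exfalso.
have c0 : mu a b != 0.
  by have := nonsquare_neq0 n1; rewrite mulf_eq0 negb_or => /andP [].
(* The values of [w], [k] and [l] are exactly the three expressions in (7). *)
apply: (@witness (mu a b ^+ 2) ((b - a ^+ 2) * mu a b)
  (b * mu a b * (a * b - 2 * a + 1)) ((a - 1) * (a * b - a + b) * mu a b)
  false true false); rewrite /=; try (rewrite /mu; ring); try by apply/negbTE.
- by neq0.
- exact: is_square_sqr.
- exact: s2.
Qed.

Lemma trivial_cond8 : cond8 a b.
Proof.
rewrite /cond8; have [m|m] := boolP (is_square (-1 : F)); first by left.
have [n|n1] := boolP (is_square (a - 1)); first by right; left.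
have [s2|n] := boolP (is_square b); last by right; right.
exfalso; apply: (@witness 1 (-1) (a - 1) b false false true) => //;
  rewrite /=; try ring; try by apply/negbTE.
- exact: oner_neq0.
- exact: is_square1.
Qed.

Lemma trivial_cond9 : cond9 a b.
Proof.
rewrite /cond9; have [m|m] := boolP (is_square (-1 : F)); first by left.
have [n|n1] := boolP (is_square a); first by right; left.
have [n|n2] := boolP (is_square ((_ + 1) * _)); first by right; right.
exfalso.
apply: (@witness ((b - 1) ^+ 2) (- ((a - 1) * (b - 1)))
  ((a * b - 2 * a + 1) * (b - 1)) (a * (b - 1) ^+ 2) false false false);
  rewrite /=; try ring; try by apply/negbTE.
- by neq0.
- by square_cases.
- by square_cases.
- by square_cases.
Qed.

(* If (1) fails then [b = a ^+ 2 = 1 - a], so [b] is a square and [a - 1 = - b]. *)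
Lemma cond1_of_cond2_cond8 : cond2 a b -> cond8 a b -> cond1 a b.
Proof.
move=> c2 c8; rewrite /cond1.
have [aE|/eqP] := eqVneq (a ^+ 2) b; last by left.
have [bE|/eqP] := eqVneq a (2 * b - b ^+ 2); last by right.
exfalso.
have bE1 : b = 1 - a.
  have : a * (a - 1) * (b - (1 - a)) = 0.
    by apply: (eq_from_sub bE); rewrite -aE; ring.
  move/eqP; rewrite !mulf_eq0 (negbTE a0) (negbTE a1) /= subr_eq0.
  by move/eqP.
have sb : is_square b by rewrite -aE is_square_sqr.
have a1E : a - 1 = - b by rewrite bE1 opprB.
(* Now [a] and [b] are squares and [a - 1] has the character of [-1]: (2) fails if [-1] is a square,
   (8) if it is not. *)
move: c2 c8; rewrite /cond2 /cond8 sab a1E sb is_squareN // sb.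
by case: (is_square _) => /=; intuition.
Qed.

Lemma trivial_conds1to9 : conds1to9 a b.
Proof.
have c2 := trivial_cond2; have c8 := trivial_cond8.
split; first exact: cond1_of_cond2_cond8.
do !split=> //; [exact: trivial_cond3|exact: trivial_cond4|exact: trivial_cond5
  |exact: trivial_cond6|exact: trivial_cond7|exact: trivial_cond9].
Qed.

End Conditions.

(** * Sufficiency: each of the eight patterns is excluded by a condition *)

(* Below, [k = a * z + w] or [l = z + w - c * w] may vanish and then counts as a square, so the
   vanishing of [sigma], [tau], etc. is treated apart. *)
Section Patterns.

Variables a b : F.
Hypotheses (a0 : a != 0) (b0 : b != 0) (a1 : a - 1 != 0) (b1 : b - 1 != 0).
Hypothesis sab : is_square a = is_square b.
Hypothesis sab1 : is_square (a - 1) = is_square (b - 1).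

Variables z w : F.
Hypotheses (z0 : z != 0) (w0 : w != 0) (sz : is_square z).

Lemma pattern_cond2 : cond2 a b -> is_square w -> is_square (a * z + w) ->
  is_square (z + w - a * w) ->
  a * (a * z + w) <> a * w + a * (z + w - a * w).
Proof.
move=> c sw sk sl e.
have zE : w = - z.
  apply: (mulfI (mulf_neq0 a0 a1)).
  by apply: (eq_from_sub e); ring.
have kE : a * z + w = (a - 1) * z by rewrite zE; ring.
have lE : z + w - a * w = a * z by rewrite zE; ring.
rewrite kE lE zE in sw sk sl.
case: c => [/negP c|[/negP c|/negP c]]; square_cases.
Qed.

Lemma pattern_cond3 : cond3 a b -> is_square w -> is_square (a * z + w) ->
  ~~ is_square (z + w - a * w) ->
  a * (a * z + w) <> a * w + b * (z + w - a * w).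
Proof.
move=> c sw sk sl e.
have /(proportional z0 w0) : (a ^+ 2 - b) * z = (- (b * (a - 1))) * w.
  by apply: (eq_from_sub e); ring.
case=> [[_ /eqP]|[s [s0 c10 c20 zE wE]]].
  by rewrite oppr_eq0 mulf_eq0 (negbTE b0) (negbTE a1).
have kE : a * z + w = - (sigma a b * s) by rewrite zE wE /sigma; ring.
have lE : z + w - a * w = - (a ^+ 2 * (a - 1) * s) by rewrite zE wE; ring.
have E : 1 - a = - (a - 1) by ring.
rewrite kE lE wE in sw sk sl; have := sz; rewrite zE => szE.
have nb : ~~ is_square b by square_cases.
(* If [sigma] vanished, [b * (a - 1) = a ^+ 2 * (b - 1)] would make [b] a square, as [a - 1] and
   [b - 1] have the same character. *)
have g0 : sigma a b != 0.
  apply: contra nb => /eqP g0.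
  have gE : b * (a - 1) = a ^+ 2 * (b - 1).
    by apply/eqP; rewrite -subr_eq0 -oppr_eq0 -g0 /sigma; apply/eqP; ring.
  have : is_square (b * (a - 1)) = is_square (a ^+ 2 * (b - 1)) by rewrite gE.
  square_cases.
rewrite /cond3 E in c.
case: c => [c|[c|c]]; square_cases.
Qed.

Lemma pattern_cond4 : cond4 a b -> is_square w -> ~~ is_square (a * z + w) ->
  is_square (z + w - a * w) ->
  b * (a * z + w) <> a * w + a * (z + w - a * w).
Proof.
move=> c sw sk sl e.
have /(proportional z0 w0) : (a * (b - 1)) * z = - nu a b * w.
  by apply: (eq_from_sub e); rewrite /nu; ring.
case=> [[/eqP]|[s [s0 _ c20 zE wE]]].
  by rewrite mulf_eq0 (negbTE a0) (negbTE b1).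
rewrite oppr_eq0 in c20.
have kE : a * z + w = - (a * (a - 1) ^+ 2 * s) by rewrite zE wE /nu; ring.
have lE : z + w - a * w = - (tau a b * s) by rewrite zE wE /nu /tau; ring.
rewrite kE lE wE in sw sk sl; have := sz; rewrite zE => szE.
have nb : ~~ is_square (- (b - 1)) by square_cases.
(* If [tau] vanished, [- (b - 1) * a = b * (a - 1) ^+ 2] would make [1 - b] a square, as [a] and [b]
   have the same character. *)
have g0 : tau a b != 0.
  apply: contra nb => /eqP g0.
  have gE : - (b - 1) * a = b * (a - 1) ^+ 2.
    by apply/eqP; rewrite eq_sym -subr_eq0 -g0 /tau; apply/eqP; ring.
  have : is_square (- (b - 1) * a) = is_square (b * (a - 1) ^+ 2) by rewrite gE.
  square_cases.
rewrite /cond4 -(opprB b 1) in c.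
case: c => [c|[c|c]]; square_cases.
Qed.

Lemma pattern_cond5 : cond5 a b -> is_square w -> ~~ is_square (a * z + w) ->
  ~~ is_square (z + w - a * w) ->
  b * (a * z + w) <> a * w + b * (z + w - a * w).
Proof.
move=> c sw sk sl e.
have /(proportional z0 w0) : (b * (a - 1)) * z = - (a * (b - 1)) * w.
  by apply: (eq_from_sub e); ring.
case=> [[/eqP]|[s [s0 _ c20 zE wE]]].
  by rewrite mulf_eq0 (negbTE b0) (negbTE a1).
have kE : a * z + w = - (sigma a b * s) by rewrite zE wE /sigma; ring.
have lE : z + w - a * w = - (tau a b * s) by rewrite zE wE /tau; ring.
rewrite kE lE wE in sw sk sl; have := sz; rewrite zE => szE.
have g0 : sigma a b != 0.
  by have := nonsquare_neq0 sk; rewrite oppr_eq0 mulf_eq0 negb_or => /andP [].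
have h0 : tau a b != 0.
  by have := nonsquare_neq0 sl; rewrite oppr_eq0 mulf_eq0 negb_or => /andP [].
case: c => [/negP c|[c|c]]; square_cases.
Qed.

Lemma pattern_cond6 : cond6 a b -> ~~ is_square w -> is_square (a * z + w) ->
  is_square (z + w - b * w) ->
  a * (a * z + w) <> b * w + a * (z + w - b * w).
Proof.
move=> c sw sk sl e.
have /(proportional z0 w0) : a * z = - b * w.
  by apply: (mulfI a1); apply: (eq_from_sub e); ring.
case=> [[/eqP]|[s [s0 _ c20 zE wE]]]; first by rewrite (negbTE a0).
have kE : a * z + w = - (a * (b - 1) * s) by rewrite zE wE; ring.
have lE : z + w - b * w = - ((a * b - a + b) * s) by rewrite zE wE; ring.
rewrite kE lE wE in sw sk sl; have := sz; rewrite zE => szE.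
(* If this factor vanishes, [l = 0] carries no information, but the last clause of (6) is then false
   and the characters of [z], [w] and [k] refute the others. *)
have [g0|g0] := eqVneq (a * b - a + b) 0.
  rewrite /cond6 g0 mul0r is_square0 in c.
  by case: c => [c|[/negP c|[]//]]; square_cases.
case: c => [c|[/negP c|/negP c]]; square_cases.
Qed.

Lemma pattern_cond7 : cond1 a b -> cond7 a b -> ~~ is_square w ->
  is_square (a * z + w) -> ~~ is_square (z + w - b * w) ->
  a * (a * z + w) <> b * w + b * (z + w - b * w).
Proof.
move=> c1 c sw sk sl e.
have /(proportional z0 w0) : (b - a ^+ 2) * z = mu a b * w.
  by symmetry; apply: (eq_from_sub e); rewrite /mu; ring.
case=> [[/eqP aE mE]|[s [s0 c10 c20 zE wE]]].
  (* Both coefficients vanish exactly when [b = a ^+ 2] and [a = 2 * b - b ^+ 2], which (1)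
     forbids. *)
  rewrite subr_eq0 eq_sym in aE; case: c1 => [|[]]; first by move/eqP: aE.
  by apply: (eq_from_sub mE); rewrite /mu; ring.
have kE : a * z + w = b * (a * b - 2 * a + 1) * s by rewrite zE wE /mu; ring.
have lE : z + w - b * w = (a - 1) * (a * b - a + b) * s.
  by rewrite zE wE /mu; ring.
rewrite kE lE wE in sw sk sl; have := sz; rewrite zE => szE.
have h0 : a * b - a + b != 0.
  have := nonsquare_neq0 sl; rewrite !mulf_eq0 !negb_or -andbA.
  by case/and3P.
(* If [k = 0], the middle clause of (7) is false, and [w] and [l] refute the other two. *)
have [g0|g0] := eqVneq (a * b - 2 * a + 1) 0.
  rewrite /cond7 g0 mulr0 is_square0 in c.
  by case: c => [c|[[]//|c]]; square_cases.
case: c => [c|[/negP c|c]]; square_cases.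
Qed.

Lemma pattern_cond8 : cond8 a b -> ~~ is_square w -> ~~ is_square (a * z + w) ->
  is_square (z + w - b * w) ->
  b * (a * z + w) <> b * w + a * (z + w - b * w).
Proof.
move=> c sw sk sl e.
have zE : w = - z.
  apply: (mulfI (mulf_neq0 a0 b1)).
  by apply: (eq_from_sub e); ring.
have kE : a * z + w = (a - 1) * z by rewrite zE; ring.
have lE : z + w - b * w = b * z by rewrite zE; ring.
rewrite kE lE zE in sw sk sl.
case: c => [c|[c|/negP c]]; square_cases.
Qed.

Lemma pattern_cond9 : cond9 a b -> ~~ is_square w -> ~~ is_square (a * z + w) ->
  ~~ is_square (z + w - b * w) ->
  b * (a * z + w) <> b * w + b * (z + w - b * w).
Proof.
move=> c sw sk sl e.
have /(proportional z0 w0) : (a - 1) * z = - (b - 1) * w.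
  by apply: (mulfI b0); apply: (eq_from_sub e); ring.
case=> [[/eqP]|[s [s0 _ c20 zE wE]]]; first by rewrite (negbTE a1).
have kE : a * z + w = - ((a * b - 2 * a + 1) * s) by rewrite zE wE; ring.
have lE : z + w - b * w = - (a * (b - 1) * s) by rewrite zE wE; ring.
rewrite kE lE wE in sw sk sl; have := sz; rewrite zE => szE.
have g0 : a * b - 2 * a + 1 != 0.
  by have := nonsquare_neq0 sk; rewrite oppr_eq0 mulf_eq0 negb_or => /andP [].
case: c => [c|[c|c]]; square_cases.
Qed.

Lemma conds_not_assoc_pair : conds1to9 a b -> ~ assoc_pair a b z w.
Proof.
move=> [c1 [c2 [c3 [c4 [c5 [c6 [c7 [c8 c9]]]]]]]].
rewrite /assoc_pair {2}/psi sz.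
rewrite [psi a b w]/psi; case: ifPn => sw.
  rewrite /psi; case: ifPn => sk; case: ifPn => sl.
  - exact: pattern_cond2.
  - exact: pattern_cond3.
  - exact: pattern_cond4.
  - exact: pattern_cond5.
rewrite /psi; case: ifPn => sk; case: ifPn => sl.
- exact: pattern_cond6.
- exact: pattern_cond7.
- exact: pattern_cond8.
- exact: pattern_cond9.
Qed.

End Patterns.

(** * Properties of [psi], the swap of [a] and [b], and the return to [Qop] *)

Lemma psi0 a b : psi a b 0 = 0.
Proof. by rewrite /psi !mulr0 if_same. Qed.

Lemma psi_swap a b n x : ~~ is_square n -> psi b a (n * x) = n * psi a b x.
Proof.
move=> nn; have [->|x0] := eqVneq x 0; first by rewrite mulr0 !psi0 mulr0.
have n0 := nonsquare_neq0 nn.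
rewrite /psi is_squareM // (negbTE nn) /=.
by case: (is_square x); rewrite /= mulrCA.
Qed.

Lemma assoc_pair_swap a b n z w : ~~ is_square n -> assoc_pair a b z w ->
  assoc_pair b a (n * z) (n * w).
Proof.
move=> nn; rewrite /assoc_pair => e.
by rewrite !psi_swap // -!(mulrDr, mulrBr) !psi_swap // e mulrDr.
Qed.

(** Subtracting the identity gives a map of the same kind, so [psi_inj] also serves for the
    equations [x * c = d], and fixed points become zeros. *)
Lemma psi_sub_id a b x : psi a b x - x = psi (a - 1) (b - 1) x.
Proof. by rewrite /psi; case: ifP => _; rewrite mulrBl mul1r. Qed.

(** As [a] and [b] have equal characters, nonzero arguments of different characters have images of
    different characters; within one branch, cancel the coefficient. *)
Lemma psi_inj a b : a != 0 -> b != 0 -> is_square a = is_square b ->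
  injective (psi a b).
Proof.
move=> a0 b0 sab x y; rewrite /psi; case: ifPn => sx; case: ifPn => sy e.
- exact: mulfI e.
- have y0 := nonsquare_neq0 sy.
  have x0 : x != 0.
    by apply: contraTneq (mulf_neq0 b0 y0) => x0; rewrite -e x0 mulr0 eqxx.
  have : is_square (a * x) = is_square (b * y) by rewrite e.
  by rewrite !is_squareM // sab sx (negbTE sy); case: (is_square b).
- have x0 := nonsquare_neq0 sx.
  have y0 : y != 0.
    by apply: contraTneq (mulf_neq0 b0 x0) => y0; rewrite e y0 mulr0 eqxx.
  have : is_square (b * x) = is_square (a * y) by rewrite e.
  by rewrite !is_squareM // sab sy (negbTE sx); case: (is_square b).
- exact: mulfI e.
Qed.

Lemma psi_fix a b x : a - 1 != 0 -> b - 1 != 0 -> psi a b x = x -> x = 0.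
Proof.
move=> a1 b1 /eqP; rewrite -subr_eq0 psi_sub_id /psi.
by case: ifP => _; rewrite mulf_eq0 ?(negbTE a1) ?(negbTE b1) => /eqP.
Qed.

Lemma inj_exists_unique (f : F -> F) d : injective f -> exists! x, f x = d.
Proof.
move=> fI; have [g gK fK] := injF_bij fI.
by exists (g d); split=> // x <-; rewrite gK.
Qed.

Lemma Qop_quasigroup a b : a != 0 -> b != 0 -> a - 1 != 0 -> b - 1 != 0 ->
  is_square a = is_square b -> is_square (a - 1) = is_square (b - 1) ->
  is_quasigroup (Qop a b).
Proof.
move=> a0 b0 a1 b1 sab sab1 c d; split; apply: inj_exists_unique => x y.
  have QE t : Qop a b t c = c + psi (a - 1) (b - 1) (c - t).
    by rewrite -psi_sub_id /Qop; ring.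
  by rewrite !QE => /addrI /(psi_inj a1 b1 sab1) /addrI /oppr_inj.
by rewrite /Qop => /addrI /(psi_inj a0 b0 sab) /addIr.
Qed.

Lemma Qop_assocE a b x y z :
  Qop a b x (Qop a b y z) = Qop a b (Qop a b x y) z <->
  assoc_pair a b (z - y) (y - x).
Proof.
rewrite /Qop /assoc_pair; set p := psi a b (z - y); set q := psi a b (y - x).
have -> : y + p - x = p + (y - x) by ring.
have -> : z - (x + q) = z - y + (y - x) - q by ring.
by rewrite -[x + q + _]addrA; split=> [/addrI|->].
Qed.

(** Asking only for [z - y = 0] is enough: with [w = y - x] the equation then reads
    [psi (w - psi w) = 0], so [w] is a fixed point of [psi], hence [0]. *)
Lemma trivially_assocP a b : a != 0 -> b != 0 -> a - 1 != 0 -> b - 1 != 0 ->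
  is_square a = is_square b ->
  trivially_assoc a b <->
  (forall x y z, Qop a b x (Qop a b y z) = Qop a b (Qop a b x y) z ->
     x = y /\ y = z).
Proof.
move=> a0 b0 a1 b1 sab; split=> [triv x y z /Qop_assocE e|mna z w e].
  have zy : z - y = 0 := triv _ _ e.
  have yx : y - x = 0.
    move: e; rewrite zy /assoc_pair psi0 !add0r; set w := y - x => e.
    have /addrI pw : psi a b w + psi a b (w - psi a b w) = psi a b w + 0.
      by rewrite addr0 -e.
    have /eqP : w - psi a b w = 0 by apply: (psi_inj a0 b0 sab); rewrite pw psi0.
    by rewrite subr_eq0 => /eqP /esym; apply: psi_fix.
  by move/eqP: zy; move/eqP: yx; rewrite !subr_eq0 => /eqP -> /eqP ->.
(* By translation, the middle element may be taken to be [0]. *)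
have [] := mna (- w) 0 z.
  by apply/Qop_assocE; rewrite subr0 opprK add0r.
by move=> _ ->.
Qed.

Lemma trivially_assoc_swap a b n : ~~ is_square n ->
  trivially_assoc a b -> trivially_assoc b a.
Proof.
move=> nn triv z w /(assoc_pair_swap nn) /triv /eqP.
by rewrite mulf_eq0 (negbTE (nonsquare_neq0 nn)) => /eqP.
Qed.

Lemma conds_trivially_assoc a b n : ~~ is_square n ->
  a != 0 -> b != 0 -> a - 1 != 0 -> b - 1 != 0 ->
  is_square a = is_square b -> is_square (a - 1) = is_square (b - 1) ->
  conds1to9 a b -> conds1to9 b a -> trivially_assoc a b.
Proof.
move=> nn a0 b0 a1 b1 sab sab1 cab cba z w e; apply/eqP; apply: contraT => z0.
have n0 := nonsquare_neq0 nn.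
have w0 : w != 0.
  (* For [w = 0] the equation says that [psi z] is a fixed point of [psi] up to injectivity:
     [psi (psi z) = psi z] gives [psi z = z], so [z = 0]. *)
  apply: contraNneq z0 => w0; move: e; rewrite /assoc_pair w0 psi0 !addr0 subr0 add0r.
  by move/(psi_inj a0 b0 sab)/(psi_fix a1 b1) ->.
have [sz|nz] := boolP (is_square z).
  by case: (conds_not_assoc_pair a0 b0 a1 b1 sab sab1 z0 w0 sz cab).
have e' := assoc_pair_swap nn e.
have snz := nonsquareM nn nz.
by case: (conds_not_assoc_pair b0 a0 b1 a1 (esym sab) (esym sab1)
  (mulf_neq0 n0 z0) (mulf_neq0 n0 w0) snz cba e').
Qed.

End Associativity.

Theorem theorem3p5 (F : finFieldType) (hodd : odd #|F|) (a b : F)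
    (hab : (a, b) \in Sigma F) :
  maximally_nonassociative (Qop a b) <->
  (conds1to9 a b /\ conds1to9 b a).
Proof.
have [n nn] := exists_nonsquare hodd.
move: hab; rewrite inE !in_cons in_nil orbF !negb_or ![0 == _]eq_sym.
case/and4P => /and4P [a0 b0 a1 b1] _; rewrite !is_squareM //.
rewrite !negb_add => /eqP sab /eqP sab1.
split=> [[_ /(trivially_assocP a0 b0 a1 b1 sab) triv]|[cab cba]].
  have triv' := trivially_assoc_swap nn triv.
  by split; apply: trivial_conds1to9.
split; first exact: Qop_quasigroup.
by apply/(trivially_assocP a0 b0 a1 b1 sab); apply: conds_trivially_assoc nn _ _ _ _ _ _ _ _.
Qed.
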